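(* The quantum automorphism group of the semi-circulant graph $C_{12}(3^+,6)$ is $H_2^+\times S_3$; that is, $G_{aut}^+(C_{12}(3^+,6))$ and $H_2^+\times S_3$ are isomorphic as compact quantum groups.
   Context: Graphs are finite, undirected, without loops and multiple edges. $C_{12}(3^+,6)$ is the graph with vertex set $\{1,\dots,12\}$ whose edges are: $\{i,j\}$ with $\min(|i-j|,12-|i-j|)\in\{1,6\}$, together with $\{i,j\}$ with $i$ even and $j\equiv i+3\pmod{12}$. For a graph $\Gamma$ with vertex set $V$ and adjacency matrix $A$, the quantum automorphism group $G_{aut}^+(\Gamma)$ is the compact matrix quantum group whose algebra $C(G_{aut}^+(\Gamma))$ is the universal unital $C^*$-algebra generated by $u_{ij}$ ($i,j\in V$) subject to $u_{ij}=u_{ij}^*=u_{ij}^2$, $\sum_k u_{ik}=1=\sum_k u_{ki}$ for all $i$, and $Au=uA$, with comultiplication $\Delta(u_{ij})=\sum_k u_{ik}\otimes u_{kj}$. $H_2^+$ is the hyperoctahedral quantum group, which is the quantum automorphism group $G_{aut}^+(C_4)$ of the $4$-cycle $C_4$. $H_2^+\times S_3$ is the direct product: $C(H_2^+\times S_3)$ is the universal unital $C^*$-algebra generated by $v_{ij}$ ($1\le i,j\le 4$) and $w_{kl}$ ($1\le k,l\le 3$) such that all $v_{ij},w_{kl}$ are self-adjoint projections, all rows and columns of $v$ and of $w$ sum to $1$, $A_{C_4}v=vA_{C_4}$ (where $A_{C_4}$ is the adjacency matrix of $C_4$), and $v_{ij}w_{kl}=w_{kl}v_{ij}$ for all indices;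 the comultiplication is $\Delta(v_{ij})=\sum_a v_{ia}\otimes v_{aj}$, $\Delta(w_{kl})=\sum_b w_{kb}\otimes w_{bl}$. Isomorphism of compact quantum groups means a $*$-isomorphism of the algebras intertwining the comultiplications. *)

(* Defs.v *)
From HB Require Import structures.
From mathcomp Require Import all_boot all_order all_algebra.
From mathcomp Require Import complex.
From mathcomp Require Import reals.
Import Order.TTheory GRing.Theory Num.Theory.

Set Implicit Arguments.
Unset Strict Implicit.
Unset Printing Implicit Defensive.

Local Open Scope ring_scope.

(* Unital C*-algebras over R[i].  The norm is part of the mixin because
   Hierarchy Builder rejects a join of GRing.Algebra and NormedModule that
   NumDomain does not inherit from.  Being an algType, a C*-algebra is nonzero
   here; the zero algebra plays no role as the target of a universal property. *)
HB.mixin Record isCstarAlgebra (R : realType) A of GRing.Algebra R[i] A := {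
  star : A -> A;
  starK : involutive star;
  starD : forall x y : A, star (x + y) = star x + star y;
  starZ : forall (a : R[i]) (x : A), star (a *: x) = Num.conj a *: star x;
  starM : forall x y : A, star (x * y) = star y * star x;
  cnorm : A -> R;
  cnorm0_eq0 : forall x : A, cnorm x = 0 -> x = 0;
  cnormD : forall x y : A, cnorm (x + y) <= cnorm x + cnorm y;
  cnormZ : forall (a : R[i]) (x : A),
    cnorm (a *: x) = ComplexField.Normc.normc a * cnorm x;
  cnormM : forall x y : A, cnorm (x * y) <= cnorm x * cnorm y;
  cnorm_star : forall x : A, cnorm (star x * x) = cnorm x ^+ 2;
  cnorm_complete : forall u : nat -> A,
    (forall e, 0 < e ->
       exists N, forall m n, (N <= m)%N -> (N <= n)%N ->
         cnorm (u m - u n) < e) ->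
    exists l, forall e, 0 < e ->
      exists N, forall n, (N <= n)%N -> cnorm (u n - l) < e
}.

#[short(type="cstarAlgType")]
HB.structure Definition CstarAlgebra (R : realType) :=
  {A of GRing.Algebra R[i] A & isCstarAlgebra R A}.

(* As an lrmorphism is C-linear, multiplicative and unital, this says that f is
   a unital *-homomorphism. *)
Definition star_hom (R : realType) (A B : cstarAlgType R)
    (f : {lrmorphism A -> B}) : Prop :=
  forall x, f (star x) = star (f x).

Section UniversalAlgebra.
Variables (R : realType) (X : Type).
Implicit Type A B : cstarAlgType R.

(* A system of relations on a family of generators indexed by X. *)
Definition relations := forall A, (X -> A) -> Prop.

Definition is_universal (rel : relations) A (g : X -> A) : Prop :=
  rel A g /\
  forall B (h : X -> B), rel B h ->
    exists f : {lrmorphism A -> B},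
      [/\ star_hom f, forall x, f (g x) = h x
        & forall f' : {lrmorphism A -> B}, star_hom f' ->
            (forall x, f' (g x) = h x) -> f' =1 f].

End UniversalAlgebra.

Section TensorProduct.
Variables (R : realType) (A B : cstarAlgType R).
Implicit Type T : cstarAlgType R.

(* A finite formal sum of elementary tensors a (x) b is a list of pairs (a, b);
   it is zero in the algebraic tensor product iff every bilinear map kills it. *)
Definition tensor_null (s : seq (A * B)) : Prop :=
  forall (V : lmodType R[i]) (f : {bilinear A -> B -> V}),
    \sum_(p <- s) f p.1 p.2 = 0.

Definition tensor_eval T (il : A -> T) (ir : B -> T) (s : seq (A * B)) : T :=
  \sum_(p <- s) il p.1 * ir p.2.

(* il and ir embed the algebraic tensor product of A and B as a *-subalgebra of
   T through a (x) b |-> il a * ir b; equivalently, T induces a C*-norm on it. *)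
Definition tensor_embedding T
    (il : {lrmorphism A -> T}) (ir : {lrmorphism B -> T}) : Prop :=
  [/\ star_hom il, star_hom ir, forall a b, il a * ir b = ir b * il a
    & forall s, tensor_eval il ir s = 0 -> tensor_null s].

(* T is the completion of the algebraic tensor product for its smallest C*-norm,
   i.e. the minimal (spatial) tensor product. *)
Definition is_min_tensor T
    (il : {lrmorphism A -> T}) (ir : {lrmorphism B -> T}) : Prop :=
  [/\ tensor_embedding il ir,
      forall (t : T) (e : R), 0 < e ->
        exists s, cnorm (t - tensor_eval il ir s) < e
    & forall T' (il' : {lrmorphism A -> T'}) (ir' : {lrmorphism B -> T'}),
        tensor_embedding il' ir' ->
        forall s, cnorm (tensor_eval il ir s) <= cnorm (tensor_eval il' ir' s)].

End TensorProduct.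

(* A pair (C(G), Delta).  The quantum groups below are determined by universal
   presentations of C(G) together with the values of Delta on the generators;
   coassociativity and the density conditions then follow. *)
Record comulAlg (R : realType) := ComulAlg {
  calg :> cstarAlgType R;
  ctensor : cstarAlgType R;
  tinl : {lrmorphism calg -> ctensor};
  tinr : {lrmorphism calg -> ctensor};
  ctensorP : is_min_tensor tinl tinr;
  comul : {lrmorphism calg -> ctensor};
  comul_star : star_hom comul
}.

(* F below is phi (x) phi: it is determined by its values on both legs. *)
Definition cqg_isomorphic (R : realType) (G H : comulAlg R) : Prop :=
  exists (phi : {lrmorphism G -> H}) (F : {lrmorphism ctensor G -> ctensor H}),
    [/\ star_hom phi, bijective phi, star_hom F,
        (forall x, F (tinl G x) = tinl H (phi x)) /\
        (forall x, F (tinr G x) = tinr H (phi x))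
      & forall x, F (comul G x) = comul H (phi x)].

Section MagicUnitaries.
Variables (R : realType) (A : cstarAlgType R).

Definition projection (p : A) : Prop := star p = p /\ p * p = p.

Definition magic n (u : 'M[A]_n) : Prop :=
  [/\ forall i j, projection (u i j),
      forall i, \sum_k u i k = 1
    & forall i, \sum_k u k i = 1].

Definition adjmx n (e : rel 'I_n) : 'M[A]_n := \matrix_(i, j) (e i j)%:R.

Definition qaut_rel n (e : rel 'I_n) (u : 'M[A]_n) : Prop :=
  magic u /\ adjmx e *m u = u *m adjmx e.

End MagicUnitaries.

(* Delta(u_ij) = sum_k u_ik (x) u_kj *)
Definition matrix_comul (R : realType) (G : comulAlg R) n (u : 'M[G]_n) : Prop :=
  forall i j, comul G (u i j) = \sum_k tinl G (u i k) * tinr G (u k j).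

Definition is_qaut (R : realType) n (e : rel 'I_n) (G : comulAlg R) : Prop :=
  exists u : 'M[G]_n,
    is_universal
      (fun A (g : 'I_n * 'I_n -> A) => qaut_rel e (\matrix_(i, j) g (i, j)))
      (fun x => u x.1 x.2) /\
    matrix_comul u.

Definition C4 : rel 'I_4 :=
  fun i j => (j == i + 1 %[mod 4])%N || (i == j + 1 %[mod 4])%N.

(* The generators v_ij are indexed by the left summand, the w_kl by the right. *)
Definition is_H2plus_prod_S3 (R : realType) (G : comulAlg R) : Prop :=
  exists (v : 'M[G]_4) (w : 'M[G]_3),
    [/\ is_universal
          (fun A (g : ('I_4 * 'I_4) + ('I_3 * 'I_3) -> A) =>
             [/\ qaut_rel C4 (\matrix_(i, j) g (inl (i, j))),
                 magic (\matrix_(k, l) g (inr (k, l)))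
               & forall i j k l, g (inl (i, j)) * g (inr (k, l)) =
                                 g (inr (k, l)) * g (inl (i, j))])
          (fun x => match x with
                    | inl p => v p.1 p.2
                    | inr q => w q.1 q.2
                    end),
        matrix_comul v
      & matrix_comul w].

(* Edges of the semi-circulant graph C_12(3^+,6), on the labels 1, ..., 12. *)
Definition C12_3p6_edge (a b : nat) : bool :=
  let d := ((a - b) + (b - a))%N in
  [|| minn d (12 - d) \in [:: 1; 6]%N,
      ~~ odd a && (b == a + 3 %[mod 12])%N
    | ~~ odd b && (a == b + 3 %[mod 12])%N].

(* The element i of 'I_12 stands for the vertex labelled i + 1. *)
Definition C12_3p6 : rel 'I_12 := fun i j => C12_3p6_edge i.+1 j.+1.

(* Main.v *)
Require Import Defs.
From HB Require Import structures.
From mathcomp Require Import all_boot all_order all_algebra.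
From mathcomp Require Import complex boolp reals ring lra.
Import Order.TTheory GRing.Theory Num.Theory.

Set Implicit Arguments.
Unset Strict Implicit.
Unset Printing Implicit Defensive.

Local Open Scope ring_scope.

(** Label the twelve vertices by pairs (x, k) with x in Z/4 and k in a set of
    three blocks, so that each block is a 4-cycle and two distinct blocks are
    joined by the matching of every x with its antipode x + 2.  In these
    coordinates the adjacency matrix is A_C4 (x) I + T (x) (J - I), where T is
    the antipodal permutation of the 4-cycle ([C12_blocks]).

    If v and w are commuting magic unitaries of sizes 4 and 3 and v commutes
    with A_C4, then the products v_xy w_kl form a magic unitary that commutes
    with this adjacency matrix ([prod_qaut]).  Conversely, let u be a magic
    unitary commuting with the adjacency matrix.  The integer matrices commuting
    with u are closed under products and also under all entrywise operations,
    since f commutes with u exactly when u_ij u_kl = 0 for f(i,k) <> f(j,l)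
    ([preserves_intertwine]).  Counting common neighbours therefore shows that u
    preserves the relation of having the same coordinate x, then the cycle
    relation on x, then the relation of lying in the same block.  Summing the
    entries of u over the fibres of each coordinate gives magic unitaries v and
    w with u_(x,k),(y,l) = v_xy w_kl = w_kl v_xy ([quot_quot_mul]).  The two
    constructions are mutually inverse, so the universal properties turn them
    into mutually inverse *-isomorphisms, and these respect the
    comultiplications because both sides agree on generators.

    Two analytic facts support this algebra.  The first is that projections
    summing to 1 in a C*-algebra are pairwise orthogonal
    ([sum_projections_orth]); it is deduced from the extremality of a projection
    in the unit ball of its corner ([corner_extreme]), for which an elementary
    argument on norms of polynomials replaces the theory of positive elements.
    The second is that phi (x) phi extends to the minimal tensor products
    ([tensor_iso]): minimality of the norm makes it contractive on the algebraic
    tensor product, which is dense. *)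

(** * Norm and involution of a C*-algebra *)

Section CstarNorm.
Variables (R : realType) (A : cstarAlgType R).
Implicit Types (x y z a b p : A).

Lemma cnorm0 : cnorm (0 : A) = 0.
Proof.
by rewrite -(scale0r (0 : A)) cnormZ ComplexField.Normc.normc0 mul0r.
Qed.

Lemma cnormN x : cnorm (- x) = cnorm x.
Proof.
by rewrite -scaleN1r cnormZ normcN ComplexField.Normc.normc1 mul1r.
Qed.

Lemma cnorm_ge0 x : 0 <= cnorm x.
Proof.
have := cnormD x (- x); rewrite subrr cnorm0 cnormN; lra.
Qed.

Lemma cnormMn x n : cnorm (x *+ n) = cnorm x *+ n.
Proof.
by rewrite -scaler_nat cnormZ normcMn ComplexField.Normc.normc1 mulrC mulr_natr.
Qed.

Lemma cnormB x y : cnorm (x - y) <= cnorm x + cnorm y.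
Proof. by rewrite -[cnorm y]cnormN cnormD. Qed.

Lemma cnormBC x y : cnorm (x - y) = cnorm (y - x).
Proof. by rewrite -cnormN opprB. Qed.

Lemma cnorm_trans x y z : cnorm (x - z) <= cnorm (x - y) + cnorm (y - z).
Proof. by have := cnormD (x - y) (y - z); rewrite addrA subrK. Qed.

Lemma cnorm_eq0_lim x : (forall e, 0 < e -> cnorm x < e) -> x = 0.
Proof.
move=> small; apply: cnorm0_eq0; apply/eqP; rewrite eq_le cnorm_ge0 andbT.
by rewrite leNgt; apply/negP => /small; rewrite ltxx.
Qed.

Lemma cnorm_mul_close x y a b (d : R) : d <= 1 ->
    cnorm (x - a) < d -> cnorm (y - b) < d ->
  cnorm (x * y - a * b) <= d * (1 + cnorm x + cnorm y).
Proof.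
move=> d_le1 xa yb.
have := cnorm_trans (x * y) (a * y) (a * b).
rewrite -mulrBl -mulrBr.
have := cnormM (x - a) y; have := cnormM a (y - b).
have := cnorm_trans a x 0; rewrite !subr0 (cnormBC a).
have := cnorm_ge0 a; have := cnorm_ge0 x; have := cnorm_ge0 y.
have := cnorm_ge0 (x - a); have := cnorm_ge0 (y - b).
nra.
Qed.

Lemma cnorm_star_eq x : cnorm (star x) = cnorm x.
Proof.
have le_star y : cnorm y <= cnorm (star y).
  have := cnormM (star y) y; rewrite cnorm_star expr2.
  have := cnorm_ge0 y; rewrite le_eqVlt => /orP[/eqP <- _|y_gt0].
    exact: cnorm_ge0.
  by rewrite ler_pM2r.
by apply/eqP; rewrite eq_le le_star -{2}[x]starK le_star.
Qed.

Lemma cnorm_sum I (r : seq I) (F : I -> A) (P : pred I) :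
  cnorm (\sum_(i <- r | P i) F i) <= \sum_(i <- r | P i) cnorm (F i).
Proof.
elim/big_rec2: _ => [|i y x _ le_xy]; first by rewrite cnorm0.
by apply: le_trans (cnormD _ _) _; rewrite lerD2l.
Qed.

Lemma star0 : star (0 : A) = 0.
Proof. by apply: (addrI (star 0)); rewrite -starD !addr0. Qed.

Lemma starN x : star (- x) = - star x.
Proof. by apply: (addrI (star x)); rewrite -starD !subrr star0. Qed.

Lemma star1 : star (1 : A) = 1.
Proof.
by rewrite -[star 1]mulr1 -[1 in X in _ * X]starK -starM mulr1 starK.
Qed.

Lemma star_sum I (r : seq I) (F : I -> A) (P : pred I) :
  star (\sum_(i <- r | P i) F i) = \sum_(i <- r | P i) star (F i).
Proof. exact: (big_morph _ starD star0). Qed.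

Lemma cnormM_le1 x y : cnorm x <= 1 -> cnorm y <= 1 -> cnorm (x * y) <= 1.
Proof.
move=> x1 y1; apply: le_trans (cnormM x y) _.
by apply: mulr_ile1; rewrite ?cnorm_ge0.
Qed.

Lemma projection_cnorm_le1 p : projection p -> cnorm p <= 1.
Proof.
case=> p_sa p_idem; have := cnorm_star p.
have := cnorm_ge0 p; rewrite p_sa p_idem; nra.
Qed.

Lemma cnorm_star_mul_eq0 x : star x * x = 0 -> x = 0.
Proof.
move=> xx0; apply: cnorm0_eq0; apply/eqP.
by rewrite -sqrf_eq0 -cnorm_star xx0 cnorm0.
Qed.

End CstarNorm.

(** * Orthogonality of projections summing to 1 *)

Section Extreme.
Variables (R : realType) (A : cstarAlgType R).
Implicit Types (x e c : A) (f g : {poly R[i]}).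

(** Evaluation of polynomials at c in the corner of the projection e, whose unit
    is e; it turns the computations below into polynomial identities. *)
Definition corner_poly e c f : A := e * horner_alg c f.

Lemma corner_polyM e c f g : projection e -> e * c = c -> c * e = c ->
  corner_poly e c (f * g) = corner_poly e c f * corner_poly e c g.
Proof.
move=> [_ ee] ec ce; rewrite /corner_poly rmorphM /= !mulrA; congr (_ * _).
have comm_f : e * horner_alg c f = horner_alg c f * e.
  elim/poly_ind: f => [|f a IHf]; first by rewrite rmorph0 mulr0 mul0r.
  rewrite rmorphD rmorphM /= horner_algX horner_algC mulrDl mulrDr.
  by rewrite mulrA IHf -!mulrA ce ec -scalerAr -scalerAl mulr1 mul1r.
by rewrite comm_f -mulrA ee.
Qed.

Lemma corner_polyD e c f g :
  corner_poly e c (f + g) = corner_poly e c f + corner_poly e c g.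
Proof. by rewrite /corner_poly rmorphD mulrDr. Qed.

(** Writing P for the polynomials whose value at c, in the corner of e, lies in
    the unit ball, P is closed under products and convex combinations and
    contains 1 + X and 1 - X, hence also 1 + X^2 and 1 - X^2.  Since
    (e + ic)^* (e + ic) = e + c^2, the C*-identity puts 1 + iX and 1 - iX in P,
    and the mean of their cubes is 1 - 3X^2.  Finally 1 + 3/2 X is the mean of
    (1 + X)^3, 1 - 3X^2, (1 + X)(1 - X^2) and (1 + X)^2. *)
Lemma corner_stretch e c : projection e -> e * c = c -> c * e = c ->
    star c = c -> cnorm (e + c) <= 1 -> cnorm (e - c) <= 1 ->
  cnorm (e + (3 / 2 : R[i]) *: c) <= 1.
Proof.
move=> e_proj ec ce c_sa le_add le_sub.
pose N f := cnorm (corner_poly e c f).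
have poly1 : corner_poly e c 1 = e by rewrite /corner_poly rmorph1 mulr1.
have polyX : corner_poly e c 'X = c by rewrite /corner_poly /= horner_algX.
have polyCX a : corner_poly e c (a%:P * 'X) = a *: c.
  rewrite /corner_poly rmorphM /= horner_algC horner_algX -scalerAl mul1r.
  by rewrite -scalerAr ec.
have boundM f g : N f <= 1 -> N g <= 1 -> N (f * g) <= 1.
  by rewrite /N corner_polyM //; exact: cnormM_le1.
have polyMn f n : N (f *+ n) = N f *+ n.
  by rewrite -cnormMn /N /corner_poly rmorphMn mulrnAr.
have polyD f g : N (f + g) <= N f + N g by rewrite /N corner_polyD cnormD.
have polyN f : corner_poly e c (- f) = - corner_poly e c f.
  by rewrite /corner_poly rmorphN mulrN.
have bound_half f g h : N g <= 1 -> N h <= 1 -> f *+ 2 = g + h -> N f <= 1.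
  move=> g1 h1 /(congr1 N); rewrite polyMn => Nf.
  have := polyD g h; rewrite -Nf; lra.
have boundP : N (1 + 'X) <= 1 by rewrite /N corner_polyD poly1 polyX.
have boundQ : N (1 - 'X) <= 1 by rewrite /N corner_polyD polyN poly1 polyX.
have boundR : N (1 + 'X^2) <= 1.
  apply: (@bound_half _ ((1 + 'X) * (1 + 'X)) ((1 - 'X) * (1 - 'X))).
  - exact: boundM.
  - exact: boundM.
  - ring.
have boundJ (a : R[i]) : a * a = -1 -> Num.conj a = - a ->
    N (1 + a%:P * 'X) <= 1.
  move=> aa a_conj; set f := 1 + _.
  have star_f : star (corner_poly e c f) = corner_poly e c (1 - a%:P * 'X).
    rewrite !corner_polyD polyN poly1 polyCX starD starZ c_sa a_conj scaleNr.
    by case: e_proj => ->.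
  have := cnorm_star (corner_poly e c f); rewrite star_f -corner_polyM //.
  rewrite [(_ - _) * _](_ : _ = 1 - (a%:P * a%:P) * 'X^2); last first.
    by rewrite /f; ring.
  rewrite -polyCM aa polyCN mulN1r opprK => sqN.
  by rewrite -(@expr_le1 _ 2) ?cnorm_ge0 // /N -sqN.
have boundS : N (1 - 3 * 'X^2) <= 1.
  have ii : 'i * 'i = -1 :> R[i] by rewrite -expr2 sqrCi.
  have := boundJ 'i ii (conjCi _).
  have := boundJ (- 'i).
  rewrite mulrNN rmorphN /= conjCi polyCN => /(_ ii erefl).
  set a := ('i)%:P => bm bp.
  have cube f : N f <= 1 -> N (f * (f * f)) <= 1.
    by move=> f1; exact: boundM (boundM _ _ f1 f1).
  apply: (bound_half _ _ _ (cube _ bm) (cube _ bp)).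
  rewrite [RHS](_ : _ = 2 + 6 * (a * a) * 'X^2); last by ring.
  by rewrite /a -polyCM ii polyCN; ring.
have boundT : N (1 - 'X^2) <= 1.
  rewrite [X in N X](_ : _ = (1 + 'X) * (1 - 'X)); last by ring.
  exact: boundM.
have sum4 : N ((1 + ((3 / 2 : R[i])%:P * 'X)) *+ 4) <= 4.
  rewrite [X in N X](_ : _ = (1 + 'X) * ((1 + 'X) * (1 + 'X)) + (1 - 3 * 'X^2)
    + ((1 + 'X) * (1 - 'X^2) + (1 + 'X) * (1 + 'X))); last first.
    have C6 : (3 / 2 : R[i])%:P *+ 4 = 6 :> {poly R[i]}.
      by rewrite -polyCMn [_ *+ 4](_ : _ = 6%:R) ?polyC_natr //; field.
    rewrite [LHS](_ : _ = 4 + ((3 / 2 : R[i])%:P *+ 4) * 'X); last by ring.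
    by rewrite C6; ring.
  have := boundM _ _ boundP (boundM _ _ boundP boundP).
  have := boundM _ _ boundP boundT; have := boundM _ _ boundP boundP.
  set f1 := (1 + 'X) * ((1 + 'X) * _); set f2 := (1 - 3 * _).
  set f3 := (1 + 'X) * (1 - 'X^2); set f4 := (1 + 'X) * (1 + 'X).
  move=> b4 b3 b1.
  have := polyD (f1 + f2) (f3 + f4); have := polyD f1 f2; have := polyD f3 f4.
  lra.
move: sum4; rewrite polyMn /N corner_polyD poly1 polyCX; lra.
Qed.

(** Stretching c by 3/2 again and again keeps e + c and e - c in the unit ball,
    so every (3/2)^n c has norm at most 1 and c must vanish. *)
Lemma corner_extreme e c : projection e -> e * c = c -> c * e = c ->
    star c = c -> cnorm (e + c) <= 1 -> cnorm (e - c) <= 1 -> c = 0.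
Proof.
move=> e_proj ec ce c_sa le_add le_sub.
pose q : R[i] := 3 / 2.
have q_conj : Num.conj q = q.
  by rewrite /q rmorphM fmorphV !rmorph_nat.
have q_norm : ComplexField.Normc.normc q = 3 / 2.
  rewrite /q ComplexField.Normc.normcM ComplexField.Normc.normcV !normcMn.
  by rewrite ComplexField.Normc.normc1.
have iter n : cnorm (e + q ^+ n *: c) <= 1 /\ cnorm (e - q ^+ n *: c) <= 1.
  elim: n => [|n [IHp IHm]]; first by rewrite expr0 scale1r.
  have sa a : Num.conj a = a -> star (a *: c) = a *: c.
    by rewrite starZ c_sa => ->.
  have qn_conj : Num.conj (q ^+ n) = q ^+ n by rewrite rmorphXn /= q_conj.
  rewrite exprS -scalerA; split.
    by apply: corner_stretch; rewrite -?scalerAl -?scalerAr ?ec ?ce ?sa.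
  rewrite -scalerN; apply: corner_stretch; rewrite ?opprK //.
  - by rewrite mulrN -scalerAr ec.
  - by rewrite mulNr -scalerAl ce.
  - by rewrite starN sa.
have bounded n : (3 / 2) ^+ n * cnorm c <= 1.
  have [le1 le2] := iter n.
  have := cnormB (e + q ^+ n *: c) (e - q ^+ n *: c).
  rewrite opprB addrC addrA subrK -mulr2n cnormMn cnormZ.
  have -> : ComplexField.Normc.normc (q ^+ n) = (3 / 2) ^+ n.
    elim: (n) => [|k IHk]; first by rewrite ComplexField.Normc.normc1.
    by rewrite !exprS ComplexField.Normc.normcM q_norm IHk.
  lra.
have growth n : n%:R / 2 <= (3 / 2 : R) ^+ n.
  suff : 1 + n%:R / 2 <= (3 / 2 : R) ^+ n by lra.
  elim: n => [|n IHn]; first by rewrite expr0; lra.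
  by rewrite exprS -natr1; have : 0 <= n%:R :> R by []; lra.
apply: cnorm0_eq0; apply/eqP; rewrite eq_le cnorm_ge0 andbT leNgt.
apply/negP => c_gt0.
pose n := Num.truncn (2 / cnorm c).
have lt_n : 2 / cnorm c < n.+1%:R by rewrite truncnS_gt.
have := bounded n.+1; apply/negP; rewrite -ltNge.
rewrite -ltr_pdivrMr // div1r.
apply: lt_le_trans (growth _); rewrite ltr_pdivlMr //.
by rewrite mulrC.
Qed.

(** Compressing by p_i gives b_l = p_i p_l p_i with sum 0 over l <> i and with
    p_i - b_l in the unit ball.  Then - b_k is the sum of the m other b_l, so
    m p_i + b_k has norm at most m, and b_k / (m + 1) is a direction in which
    p_i can be moved both ways inside the unit ball; it vanishes by
    extremality. *)
Lemma sum_projections_orth (I : finType) (p : I -> A) :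
    (forall i, projection (p i)) -> \sum_i p i = 1 ->
  forall i k, i != k -> p i * p k = 0.
Proof.
move=> p_proj p_sum i k neq_ik.
have p_sa l : star (p l) = p l by case: (p_proj l).
have pp l : p l * p l = p l by case: (p_proj l).
suff pkp : p i * p k * p i = 0.
  apply: (can_inj starK); rewrite star0 starM !p_sa.
  apply: cnorm_star_mul_eq0; rewrite starM !p_sa.
  by rewrite !mulrA -(mulrA (p i)) pp.
pose b l := p i * p l * p i.
have b_sa l : star (b l) = b l by rewrite !starM !p_sa mulrA.
have pb l : p i * b l = b l by rewrite /b !mulrA pp.
have bp l : b l * p i = b l by rewrite /b -!mulrA pp.
have sum_b : \sum_(l | l != i) b l = 0.
  have : \sum_l b l = p i by rewrite -mulr_suml -mulr_sumr p_sum mulr1 pp.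
  rewrite (bigD1 i) //= {1}/b !pp => /(congr1 (fun x => x - p i)).
  by rewrite addrC addrK subrr.
have b_close l : cnorm (p i - b l) <= 1.
  have -> : p i - b l = p i * (1 - p l) * p i.
    by rewrite mulrBr mulrBl mulr1 pp.
  have c_proj : projection (1 - p l).
    split; first by rewrite starD starN star1 p_sa.
    by rewrite mulrBr mulr1 mulrBl mul1r pp subrr subr0.
  by apply: cnormM_le1; [apply: cnormM_le1|]; apply: projection_cnorm_le1.
pose S := [pred l | (l != i) && (l != k)].
pose m := #|S|.
have sum_close : cnorm (p i *+ m + b k) <= m%:R.
  have -> : p i *+ m + b k = \sum_(l in S) (p i - b l).
    rewrite sumrB sumr_const; congr (_ + _).
    move: sum_b; rewrite (bigD1 k) 1?eq_sym //= => /eqP.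
    by rewrite addr_eq0 => /eqP ->.
  apply: le_trans (cnorm_sum _ _ _) _.
  apply: le_trans (ler_sum _ (fun l _ => b_close l)) _.
  by rewrite sumr_const.
(* The denominator m + 1 serves both signs, also when m = 0. *)
pose a : R[i] := m.+1%:R^-1.
have a_gt0 : 0 < (m.+1%:R : R) by rewrite ltr0n.
have a_norm : ComplexField.Normc.normc a = m.+1%:R^-1.
  by rewrite ComplexField.Normc.normcV normcMn ComplexField.Normc.normc1.
have aS x : a *: (x *+ m.+1) = x.
  by rewrite -scaler_nat scalerA mulVf ?scale1r // pnatr_eq0.
have a_le n x : cnorm x <= n%:R -> (n <= m.+1)%N -> cnorm (a *: x) <= 1.
  move=> le_xn le_nm; rewrite cnormZ a_norm mulrC ler_pdivrMr // mul1r.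
  by apply: le_trans le_xn _; rewrite ler_nat.
have zero : a *: b k = 0.
  have a_conj : Num.conj a = a by rewrite fmorphV rmorph_nat.
  apply: (@corner_extreme (p i)) => //.
  - by rewrite -scalerAr pb.
  - by rewrite -scalerAl bp.
  - by rewrite starZ b_sa a_conj.
  - rewrite -[X in X + _](aS (p i)) -scalerDr; apply: (@a_le m.+1) => //.
    rewrite mulrS -addrA -natr1 addrC; apply: le_trans (cnormD _ _) _.
    by rewrite lerD // projection_cnorm_le1.
  - rewrite -[X in X - _](aS (p i)) -scalerBr; apply: (@a_le m.+1) => //.
    rewrite mulrSr -addrA -natr1; apply: le_trans (cnormD _ _) _.
    by rewrite lerD // cnormMn lerMn2r projection_cnorm_le1 ?orbT.
rewrite -/(b k) -[b k]aS -scaler_nat scalerA mulrC -scalerA zero.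
by rewrite scaler0.
Qed.

End Extreme.

(** * Relations preserved by a magic unitary *)

Lemma mulrn_neq_eq0 (K : numFieldType) (V : lmodType K) (x : V) m n :
  m != n -> x *+ m = x *+ n -> x = 0.
Proof.
move=> neq_mn /eqP; rewrite -[x *+ m]scaler_nat -[x *+ n]scaler_nat.
rewrite -subr_eq0 -scalerBl scaler_eq0 subr_eq0 eqr_nat (negPf neq_mn).
by move/eqP.
Qed.

Section Preserves.
Variables (R : realType) (A : cstarAlgType R).

(** For u a permutation matrix this says that the permutation is an automorphism
    of f. *)
Definition preserves n (S : eqType) (f : 'I_n -> 'I_n -> S) (u : 'M[A]_n) :=
  forall i j k l, f i k != f j l -> u i j * u k l = 0.

Lemma magic_row_orth n (u : 'M[A]_n) i j k :
  magic u -> j != k -> u i j * u i k = 0.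
Proof. by case=> u_proj u_row _; apply: sum_projections_orth. Qed.

Lemma magic_col_orth n (u : 'M[A]_n) i j k :
  magic u -> i != k -> u i j * u k j = 0.
Proof.
case=> u_proj _ u_col.
exact: (@sum_projections_orth _ _ _ (fun i => u i j)).
Qed.

Lemma magic_idem n (u : 'M[A]_n) i j : magic u -> u i j * u i j = u i j.
Proof. by case=> u_proj _ _; case: (u_proj i j). Qed.

Lemma magic_row_sum n (u : 'M[A]_n) (P : pred 'I_n) i j : magic u ->
  u i j * \sum_(l | P l) u i l = if P j then u i j else 0.
Proof.
move=> u_magic; rewrite mulr_sumr; case: ifP => Pj; last first.
  apply: big1 => l Pl; apply: magic_row_orth => //.
  by apply: contraTneq Pl => <-; rewrite Pj.
rewrite (bigD1 j) //= magic_idem // big1 ?addr0 // => l /andP[_ neq_lj].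
by apply: magic_row_orth => //; rewrite eq_sym.
Qed.

Lemma preserves_eq n (u : 'M[A]_n) :
  magic u -> preserves (fun i k => i == k) u.
Proof.
move=> u_magic i j k l.
have [<-|neq_ik] := eqVneq i k; have [<-|neq_jl] := eqVneq j l => // _.
  exact: magic_row_orth.
exact: magic_col_orth.
Qed.

Lemma preserves_sub n (S S' : eqType) (f : 'I_n -> 'I_n -> S)
    (g : 'I_n -> 'I_n -> S') (u : 'M[A]_n) :
    (forall i j k l, f i k = f j l -> g i k = g j l) ->
  preserves f u -> preserves g u.
Proof.
by move=> fg fu i j k l neq_g; apply: fu; apply: contraNneq neq_g => /fg ->.
Qed.

Lemma preserves_pair n (S S' : eqType) (f : 'I_n -> 'I_n -> S)
    (g : 'I_n -> 'I_n -> S') (u : 'M[A]_n) :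
    preserves f u -> preserves g u ->
  preserves (fun i k => (f i k, g i k)) u.
Proof.
by move=> fu gu i j k l; rewrite xpair_eqE negb_and => /orP[/fu|/gu].
Qed.

(** Multiplying the identity f u = u f by u_ia on the left and by u_bj on the
    right leaves, by orthogonality, f(i,b) u_ia u_bj = f(a,j) u_ia u_bj.
    Conversely, insert sum_a u_ia = 1 and sum_k u_kj = 1.  In the form
    [preserves] it is evident that the matrices commuting with u are stable
    under arbitrary entrywise operations. *)
Lemma preserves_intertwine n (f : 'I_n -> 'I_n -> nat) (u : 'M[A]_n) :
    magic u -> preserves f u <->
  forall i j, \sum_k u k j *+ f i k = \sum_k u i k *+ f k j.
Proof.
move=> u_magic; have [u_proj u_row u_col] := u_magic.
split=> [fu i j|fu i a b j].
  have -> : \sum_k u k j *+ f i k = \sum_k \sum_a (u i a * u k j) *+ f i k.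
    by apply: eq_bigr => k _; rewrite sumrMnl -mulr_suml u_row mul1r.
  rewrite exchange_big /=; apply: eq_bigr => a _.
  rewrite -[in RHS](mulr1 (u i a)) -(u_col j) mulr_sumr -sumrMnl.
  apply: eq_bigr => k _; have [-> //|neq_f] := eqVneq (f i k) (f a j).
  by rewrite fu // !mul0rn.
move=> neq_f; apply: mulrn_neq_eq0 neq_f _.
have /(congr1 (fun x => u i a * x * u b j)) := fu i j.
rewrite mulr_sumr mulr_suml (bigD1 b) //= big1 ?addr0; last first.
  by move=> k neq_kb; rewrite -mulrA mulrnAl magic_col_orth // mul0rn mulr0.
rewrite mulr_sumr mulr_suml (bigD1 a) //= big1 ?addr0; last first.
  move=> k neq_ka.
  by rewrite mulrnAr magic_row_orth 1?eq_sym // mul0rn mul0r.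
by rewrite !mulrnAr !mulrnAl -mulrA !magic_idem.
Qed.

Lemma preserves_adjmx n (e : rel 'I_n) (u : 'M[A]_n) : magic u ->
  preserves e u <-> adjmx A e *m u = u *m adjmx A e.
Proof.
move=> u_magic.
have natP : preserves e u <-> preserves (fun i j => nat_of_bool (e i j)) u.
  split; apply: preserves_sub => i j k l; first by move=> ->.
  by case: (e i k); case: (e j l).
rewrite natP preserves_intertwine //.
have mulmxE i j : (adjmx A e *m u) i j = \sum_k u k j *+ e i k.
  by rewrite mxE; apply: eq_bigr => k _; rewrite mxE mulr_natl.
have mxmulE i j : (u *m adjmx A e) i j = \sum_k u i k *+ e k j.
  by rewrite mxE; apply: eq_bigr => k _; rewrite mxE mulr_natr.
split=> [eu|/matrixP eu i j]; last by rewrite -mulmxE eu mxmulE.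
by apply/matrixP => i j; rewrite mulmxE eu mxmulE.
Qed.

Lemma preserves_mul n (f g : 'I_n -> 'I_n -> nat) (u : 'M[A]_n) : magic u ->
    preserves f u -> preserves g u ->
  preserves (fun i j => (\sum_k f i k * g k j)%N) u.
Proof.
move=> u_magic /preserves_intertwine-/(_ u_magic) fu.
move=> /preserves_intertwine-/(_ u_magic) gu.
apply/preserves_intertwine => // i j.
transitivity (\sum_m (\sum_k u k j *+ g m k) *+ f i m).
  under eq_bigr do rewrite -sumrMnr.
  rewrite exchange_big /=; apply: eq_bigr => m _.
  by rewrite -sumrMnl; apply: eq_bigr => k _; rewrite mulnC mulrnA.
under eq_bigr do rewrite gu -sumrMnl.
rewrite exchange_big /=.
transitivity (\sum_k (\sum_m u m k *+ f i m) *+ g k j).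
  apply: eq_bigr => k _; rewrite -sumrMnl; apply: eq_bigr => m _.
  by rewrite -!mulrnA mulnC.
transitivity (\sum_k \sum_m u i m *+ f m k *+ g k j).
  by apply: eq_bigr => k _; rewrite fu sumrMnl.
rewrite exchange_big /=; apply: eq_bigr => m _; rewrite -sumrMnr.
by apply: eq_bigr => k _; rewrite mulrnA.
Qed.

End Preserves.

(** * Quotient of a magic unitary by a preserved equivalence *)

Section Quotient.
Variables (R : realType) (A : cstarAlgType R) (n m : nat).
Variables (pi : 'I_n -> 'I_m) (s : 'I_m -> 'I_n).
Hypothesis sK : cancel s pi.
Variable u : 'M[A]_n.
Hypothesis u_magic : magic u.
Hypothesis pi_u : preserves (fun i k => pi i == pi k) u.

(** The section s picks one row in each fibre; by [quot_row] and [quot_col] any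
    other row, or the column sums, would do as well. *)
Definition quot_mx : 'M[A]_m :=
  \matrix_(x, y) \sum_(j | pi j == y) u (s x) j.

(** This is the commutation of u with the 0-1 matrix of the relation
    pi i = pi k, read at the entry (i, j). *)
Lemma fiber_sums i j :
  \sum_(k | pi k == pi i) u k j = \sum_(k | pi k == pi j) u i k.
Proof.
have pi_nat : preserves (fun i k => nat_of_bool (pi i == pi k)) u.
  by apply: preserves_sub pi_u => i' j' k l ->.
have /preserves_intertwine-/(_ u_magic i j) := pi_nat.
move=> sums; rewrite [LHS]big_mkcond [RHS]big_mkcond /=.
transitivity (\sum_k u k j *+ (pi i == pi k)); last rewrite sums.
  by apply: eq_bigr => k _; rewrite eq_sym; case: eqP.
by apply: eq_bigr => k _; case: eqP.
Qed.

Lemma quot_row i y : \sum_(j | pi j == y) u i j = quot_mx (pi i) y.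
Proof. by rewrite mxE -(sK y) -!fiber_sums sK. Qed.

Lemma quot_col x j : \sum_(i | pi i == x) u i j = quot_mx x (pi j).
Proof. by rewrite -(sK x) fiber_sums quot_row. Qed.

Lemma quot_magic : magic quot_mx.
Proof.
have [u_proj u_row u_col] := u_magic; split=> [x y|x|y].
- rewrite mxE; split.
    by rewrite star_sum; apply: eq_bigr => j _; case: (u_proj (s x) j).
  rewrite mulr_suml; apply: eq_bigr => j /eqP pi_j.
  by rewrite magic_row_sum // pi_j eqxx.
- rewrite -(u_row (s x)) (partition_big pi xpredT) //=.
  by apply: eq_bigr => y _; rewrite mxE.
- rewrite -(u_col (s y)) (partition_big pi xpredT) //=.
  by apply: eq_bigr => x _; rewrite quot_col sK.
Qed.

Lemma quot_preserves (S : eqType) (f : 'I_m -> 'I_m -> S) :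
  preserves (fun i k => f (pi i) (pi k)) u -> preserves f quot_mx.
Proof.
move=> fu x y x' y' neq_f; rewrite !mxE mulr_suml big1 // => j /eqP pi_j.
rewrite mulr_sumr big1 // => l /eqP pi_l.
by apply: fu; rewrite !sK pi_j pi_l.
Qed.

End Quotient.

(** * Product of two commuting magic unitaries *)

Section Product.
Variables (R : realType) (A : cstarAlgType R) (n m1 m2 : nat).
Variables (pi1 : 'I_n -> 'I_m1) (pi2 : 'I_n -> 'I_m2).
Hypothesis pi_bij : bijective (fun i => (pi1 i, pi2 i)).

Definition prod_mx (v : 'M[A]_m1) (w : 'M[A]_m2) : 'M[A]_n :=
  \matrix_(i, j) (v (pi1 i) (pi1 j) * w (pi2 i) (pi2 j)).

Lemma sum_prod_index (V : nmodType) (F : 'I_m1 -> 'I_m2 -> V) :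
  \sum_i F (pi1 i) (pi2 i) = \sum_x \sum_k F x k.
Proof.
rewrite pair_big /= (reindex (fun i => (pi1 i, pi2 i))) //=.
exact: onW_bij.
Qed.

Section Magic.
Variables (v : 'M[A]_m1) (w : 'M[A]_m2).
Hypotheses (v_magic : magic v) (w_magic : magic w).
Hypothesis vw_comm : forall i j k l, v i j * w k l = w k l * v i j.

Lemma prod_magic : magic (prod_mx v w).
Proof.
have [v_proj v_row v_col] := v_magic; have [w_proj w_row w_col] := w_magic.
split=> [i j|i|j].
- rewrite mxE; have [v_sa v_idem] := v_proj (pi1 i) (pi1 j).
  have [w_sa w_idem] := w_proj (pi2 i) (pi2 j).
  split; first by rewrite starM v_sa w_sa vw_comm.
  by rewrite mulrA -(mulrA (v _ _)) -vw_comm mulrA v_idem -mulrA w_idem.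
- under eq_bigr do rewrite mxE.
  rewrite (sum_prod_index (fun y l => v (pi1 i) y * w (pi2 i) l)).
  by under eq_bigr do rewrite -mulr_sumr w_row mulr1.
- under eq_bigr do rewrite mxE.
  rewrite (sum_prod_index (fun y l => v y (pi1 j) * w l (pi2 j))).
  by under eq_bigr do rewrite -mulr_sumr w_col mulr1.
Qed.

Lemma prod_preserves (S1 S2 : eqType) (f1 : 'I_m1 -> 'I_m1 -> S1)
    (f2 : 'I_m2 -> 'I_m2 -> S2) : preserves f1 v -> preserves f2 w ->
  preserves (fun i k => (f1 (pi1 i) (pi1 k), f2 (pi2 i) (pi2 k))) (prod_mx v w).
Proof.
move=> f1v f2w i j k l; rewrite !mxE xpair_eqE negb_and.
rewrite mulrA -(mulrA (v _ _)) -vw_comm mulrA => /orP[/f1v->|/f2w w0].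
  by rewrite !mul0r.
by rewrite -mulrA w0 mulr0.
Qed.

End Magic.

Variables (s1 : 'I_m1 -> 'I_n) (s2 : 'I_m2 -> 'I_n).
Hypotheses (s1K : cancel s1 pi1) (s2K : cancel s2 pi2).
Variable u : 'M[A]_n.
Hypothesis u_magic : magic u.
Hypotheses (pi1_u : preserves (fun i k => pi1 i == pi1 k) u)
           (pi2_u : preserves (fun i k => pi2 i == pi2 k) u).

Lemma row_sum_and (P Q : pred 'I_n) i j :
    (forall l, P l && Q l = (l == j)) ->
  (\sum_(l | P l) u i l) * (\sum_(l | Q l) u i l) = u i j.
Proof.
move=> PQ; rewrite mulr_suml.
transitivity (\sum_(l | P l) if Q l then u i l else 0).
  by apply: eq_bigr => l _; rewrite magic_row_sum.
by rewrite -big_mkcondr (eq_bigl _ _ PQ) big_pred1_eq.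
Qed.

Lemma pi_eq j l : (pi1 l == pi1 j) && (pi2 l == pi2 j) = (l == j).
Proof. by rewrite -xpair_eqE (inj_eq (bij_inj pi_bij)). Qed.

(** Both factors are partial sums of row i of u, whose entries are orthogonal
    projections, so only the common index j survives. *)
Lemma quot_quot_mul i j :
  quot_mx pi1 s1 u (pi1 i) (pi1 j) * quot_mx pi2 s2 u (pi2 i) (pi2 j) = u i j.
Proof. by rewrite -!quot_row //; apply: row_sum_and => l; exact: pi_eq. Qed.

Lemma quot_quot_mul_rev i j :
  quot_mx pi2 s2 u (pi2 i) (pi2 j) * quot_mx pi1 s1 u (pi1 i) (pi1 j) = u i j.
Proof.
by rewrite -!quot_row //; apply: row_sum_and => l; rewrite andbC; exact: pi_eq.
Qed.

Lemma quot_quot_comm x y k l :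
  quot_mx pi1 s1 u x y * quot_mx pi2 s2 u k l =
  quot_mx pi2 s2 u k l * quot_mx pi1 s1 u x y.
Proof.
case: pi_bij => p _ piK.
move: (p (x, k)) (piK (x, k)) (p (y, l)) (piK (y, l)) => i [<- <-] j [<- <-].
by rewrite quot_quot_mul quot_quot_mul_rev.
Qed.

End Product.

Section Inverse.
Variables (R : realType) (A : cstarAlgType R) (n m1 m2 : nat).
Variables (pi1 : 'I_n -> 'I_m1) (pi2 : 'I_n -> 'I_m2).
Hypothesis pi_bij : bijective (fun i => (pi1 i, pi2 i)).
Variables (v : 'M[A]_m1) (w : 'M[A]_m2).

Lemma quot_prod_l (s1 : 'I_m1 -> 'I_n) : cancel s1 pi1 -> magic w ->
  quot_mx pi1 s1 (prod_mx pi1 pi2 v w) = v.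
Proof.
move=> s1K [_ w_row _]; apply/matrixP => x y; rewrite mxE big_mkcond /=.
under eq_bigr do rewrite mxE s1K.
rewrite (sum_prod_index pi_bij (fun y' l =>
  if y' == y then v x y' * w (pi2 (s1 x)) l else 0)).
rewrite (bigD1 y) //= eqxx -mulr_sumr w_row mulr1 big1 ?addr0 // => y' neq_y.
by rewrite (negPf neq_y) big1.
Qed.

Lemma quot_prod_r (s2 : 'I_m2 -> 'I_n) : cancel s2 pi2 -> magic v ->
  quot_mx pi2 s2 (prod_mx pi1 pi2 v w) = w.
Proof.
move=> s2K [_ v_row _]; apply/matrixP => k l; rewrite mxE big_mkcond /=.
under eq_bigr do rewrite mxE s2K.
rewrite (sum_prod_index pi_bij (fun y l' =>
  if l' == l then v (pi1 (s2 k)) y * w k l' else 0)) exchange_big /=.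
rewrite (bigD1 l) //= eqxx -mulr_suml v_row mul1r big1 ?addr0 // => l' neq_l.
by rewrite (negPf neq_l) big1.
Qed.

End Inverse.

(** * Block structure of the graph *)

Section Graph.

(** Vertex i carries the label n = i + 1.  The block of n is n/2 mod 3, that is,
    the 4-cycle 2m, 2m + 1, 2m + 7, 2m + 6, and the position on this cycle only
    depends on n mod 4; the table lists it for n = 1, 2, 3, 4, numbering each
    cycle in such a way that the edges between blocks become antipodal. *)
Definition pos_nat a : nat := nth 0%N [:: 0; 2; 1; 3]%N (a %% 4).
Definition blk_nat a : nat := (a.+1)./2 %% 3.

Lemma pos_nat_lt a : (pos_nat a < 4)%N.
Proof.
rewrite /pos_nat; move: (a %% 4)%N (ltn_pmod a (isT : 0 < 4)%N).
by case=> [|[|[|[|]]]].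
Qed.

Definition pos (i : 'I_12) : 'I_4 := Ordinal (pos_nat_lt i).
Definition blk (i : 'I_12) : 'I_3 :=
  Ordinal (ltn_pmod (i.+1)./2 (isT : 0 < 3)%N).

Definition C4_nat a b := (b == a + 1 %[mod 4])%N || (a == b + 1 %[mod 4])%N.

(** Ordinals do not reduce well, so statements about pairs of vertices are
    decided on their values. *)
Lemma all_pairs_12 (P : nat -> nat -> bool) :
    all (fun a => all (P a) (iota 0 12)) (iota 0 12) ->
  forall i j : 'I_12, P i j.
Proof.
move=> /allP P12 i j; have in_iota (k : 'I_12) : (k : nat) \in iota 0 12.
  by rewrite mem_iota ltn_ord.
by have /allP := P12 i (in_iota i); apply.
Qed.

Lemma sum_12 (F : nat -> nat) :
  (\sum_(k < 12) F k)%N = sumn [seq F k | k <- iota 0 12].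
Proof. by rewrite sumnE big_map -(big_mkord xpredT F) /index_iota subn0. Qed.

Lemma pos_blk_bij : bijective (fun i => (pos i, blk i)).
Proof.
apply: inj_card_bij; last by rewrite card_prod !card_ord.
move=> i j [pos_ij blk_ij]; apply: val_inj; apply/eqP.
have := @all_pairs_12 (fun a b => (pos_nat a == pos_nat b) &&
  (blk_nat a == blk_nat b) ==> (a == b)) isT i j.
by move/implyP; apply; rewrite pos_ij /blk_nat blk_ij !eqxx.
Qed.

Lemma C12_blocks i j :
  C12_3p6 i j = if blk i == blk j then C4 (pos i) (pos j)
                else (pos i != pos j) && ~~ C4 (pos i) (pos j).
Proof.
apply/(@eqP bool); exact: (@all_pairs_12 (fun a b => C12_3p6_edge a.+1 b.+1 ==
  if blk_nat a == blk_nat b then C4_nat (pos_nat a) (pos_nat b)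
  else (pos_nat a != pos_nat b) && ~~ C4_nat (pos_nat a) (pos_nat b)) isT).
Qed.

(** Two vertices have 4 common neighbours if they are equal and 1 if they have
    the same position in different blocks; otherwise they have 0 or 2. *)
Lemma same_pos_paths i j :
  (pos i == pos j) =
  ((\sum_k C12_3p6 i k * C12_3p6 k j)%N \in [:: 1; 4]%N).
Proof.
rewrite (sum_12 (fun k => C12_3p6_edge i.+1 k.+1 * C12_3p6_edge k.+1 j.+1)%N).
apply/(@eqP bool); exact: (@all_pairs_12 (fun a b => (pos_nat a == pos_nat b) ==
  (sumn [seq (C12_3p6_edge a.+1 k.+1 * C12_3p6_edge k.+1 b.+1)%N
        | k <- iota 0 12] \in [:: 1; 4]%N)) isT).
Qed.

(** Among the three vertices in the position of i, the number of neighbours of j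
    is 1 if the positions of i and j are adjacent, 2 if they are antipodal and 0
    if they are equal. *)
Lemma C4_pos_paths i j :
  C4 (pos i) (pos j) =
  ((\sum_k (pos i == pos k) * C12_3p6 k j)%N == 1%N).
Proof.
rewrite (sum_12 (fun k => (pos_nat i == pos_nat k) * C12_3p6_edge k.+1 j.+1)%N).
apply/(@eqP bool).
exact: (@all_pairs_12 (fun a b => C4_nat (pos_nat a) (pos_nat b) ==
  (sumn [seq ((pos_nat a == pos_nat k) * C12_3p6_edge k.+1 b.+1)%N
        | k <- iota 0 12] == 1%N)) isT).
Qed.

(** For two different positions, adjacency in the graph agrees with adjacency of
    the positions inside a block and is opposite to it between blocks. *)
Lemma same_blk_edge i j :
  (blk i == blk j) =
  if pos i == pos j then i == j else C12_3p6 i j == C4 (pos i) (pos j).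
Proof.
apply/(@eqP bool); exact: (@all_pairs_12 (fun a b => (blk_nat a == blk_nat b) ==
  if pos_nat a == pos_nat b then a == b
  else C12_3p6_edge a.+1 b.+1 == C4_nat (pos_nat a) (pos_nat b)) isT).
Qed.

Variables (R : realType) (A : cstarAlgType R).

Section FromGraph.
Variable u : 'M[A]_12.
Hypothesis u_rel : qaut_rel C12_3p6 u.

Let u_magic : magic u. Proof. by case: u_rel. Qed.

Let edge_u : preserves C12_3p6 u.
Proof. by apply/preserves_adjmx => //; case: u_rel. Qed.

Lemma pos_preserved : preserves (fun i k => pos i == pos k) u.
Proof.
apply: preserves_sub (preserves_mul u_magic (f := C12_3p6) (g := C12_3p6) _ _).
- by move=> i j k l paths; rewrite !same_pos_paths paths.
- by apply: preserves_sub edge_u => i j k l ->.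
- by apply: preserves_sub edge_u => i j k l ->.
Qed.

Lemma C4_pos_preserved : preserves (fun i k => C4 (pos i) (pos k)) u.
Proof.
apply: preserves_sub
  (preserves_mul u_magic (f := fun i k => pos i == pos k) (g := C12_3p6) _ _).
- by move=> i j k l paths; rewrite !C4_pos_paths paths.
- by apply: preserves_sub pos_preserved => i j k l ->.
- by apply: preserves_sub edge_u => i j k l ->.
Qed.

Lemma blk_preserved : preserves (fun i k => blk i == blk k) u.
Proof.
apply: preserves_sub (preserves_pair (preserves_eq u_magic)
  (preserves_pair edge_u (preserves_pair pos_preserved C4_pos_preserved))).
move=> i j k l [eq_ij edge_ij pos_ij C4_ij].
by rewrite !same_blk_edge pos_ij eq_ij edge_ij C4_ij.
Qed.

End FromGraph.

Lemma prod_qaut (v : 'M[A]_4) (w : 'M[A]_3) : qaut_rel C4 v -> magic w ->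
    (forall i j k l, v i j * w k l = w k l * v i j) ->
  qaut_rel C12_3p6 (prod_mx pos blk v w).
Proof.
move=> [v_magic v_C4] w_magic vw_comm.
have t_magic := prod_magic pos_blk_bij v_magic w_magic vw_comm.
split=> //; apply/preserves_adjmx => //.
have v_pos := preserves_eq v_magic; have w_blk := preserves_eq w_magic.
move/preserves_adjmx : v_C4 => /(_ v_magic) v_C4.
apply: preserves_sub (prod_preserves (pi1 := pos) (pi2 := blk) vw_comm
  (preserves_pair v_pos v_C4) w_blk).
move=> i j k l [pos_ij C4_ij blk_ij].
by rewrite !C12_blocks pos_ij C4_ij blk_ij.
Qed.

End Graph.

(** * Functoriality of the minimal tensor product *)

Lemma comp_star_hom (R : realType) (A B C : cstarAlgType R)
    (f : {lrmorphism A -> B}) (g : {lrmorphism B -> C}) :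
  star_hom f -> star_hom g -> star_hom (g \o f).
Proof. by move=> f_star g_star x /=; rewrite f_star g_star. Qed.

Section TensorEval.
Variables (R : realType) (A B T : cstarAlgType R).
Variables (il : {lrmorphism A -> T}) (ir : {lrmorphism B -> T}).
Local Notation ev := (tensor_eval il ir).

Lemma tensor_eval1 a b : ev [:: (a, b)] = il a * ir b.
Proof. by rewrite /tensor_eval big_seq1. Qed.

Lemma tensor_eval_cat s1 s2 : ev (s1 ++ s2) = ev s1 + ev s2.
Proof. by rewrite /tensor_eval big_cat. Qed.

Definition scale_seq (c : R[i]) (s : seq (A * B)) :=
  [seq (c *: p.1, p.2) | p <- s].

Lemma tensor_eval_scale c s : ev (scale_seq c s) = c *: ev s.
Proof.
rewrite /tensor_eval big_map scaler_sumr; apply: eq_bigr => p _.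
by rewrite linearZ scalerAl.
Qed.

Definition mul_seq (s1 s2 : seq (A * B)) :=
  [seq (p.1 * q.1, p.2 * q.2) | p <- s1, q <- s2].

Definition star_seq (s : seq (A * B)) := [seq (star p.1, star p.2) | p <- s].

Hypothesis comm : forall a b, il a * ir b = ir b * il a.

Lemma tensor_eval_mul s1 s2 : ev (mul_seq s1 s2) = ev s1 * ev s2.
Proof.
rewrite /tensor_eval big_allpairs_dep /= mulr_suml; apply: eq_bigr => p _.
rewrite mulr_sumr; apply: eq_bigr => q _; rewrite !rmorphM.
by rewrite -!mulrA (mulrA (il q.1)) (comm q.1 p.2) !mulrA.
Qed.

Hypotheses (il_star : star_hom il) (ir_star : star_hom ir).

Lemma tensor_eval_star s : ev (star_seq s) = star (ev s).
Proof.
rewrite /tensor_eval big_map star_sum; apply: eq_bigr => p _.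
by rewrite /= comm il_star ir_star starM.
Qed.

End TensorEval.

Section Extension.
Variables (R : realType) (A B T T' : cstarAlgType R).
Variables (il : {lrmorphism A -> T}) (ir : {lrmorphism B -> T}).
Variables (il' : {lrmorphism A -> T'}) (ir' : {lrmorphism B -> T'}).
Local Notation ev := (tensor_eval il ir).
Local Notation ev' := (tensor_eval il' ir').
Hypotheses (comm : forall a b, il a * ir b = ir b * il a)
           (comm' : forall a b, il' a * ir' b = ir' b * il' a).
Hypotheses (il_star : star_hom il) (ir_star : star_hom ir).
Hypotheses (il'_star : star_hom il') (ir'_star : star_hom ir').
Hypothesis dense : forall (t : T) (e : R), 0 < e ->
  exists s, cnorm (t - ev s) < e.
Hypothesis contract : forall s, cnorm (ev' s) <= cnorm (ev s).

(** The closure of the graph of the map sending the image of a formal tensor in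
    T to its image in T'. *)
Definition tensor_graph (t : T) (t' : T') := forall e : R, 0 < e ->
  exists s, cnorm (t - ev s) < e /\ cnorm (t' - ev' s) < e.

Lemma contractB s1 s2 : cnorm (ev' s1 - ev' s2) <= cnorm (ev s1 - ev s2).
Proof.
have := contract (s1 ++ scale_seq (-1) s2).
by rewrite !tensor_eval_cat !tensor_eval_scale !scaleN1r.
Qed.

Lemma tensor_graph_fun t x y : tensor_graph t x -> tensor_graph t y -> x = y.
Proof.
move=> tx ty; apply/eqP; rewrite -subr_eq0; apply/eqP.
apply: cnorm_eq0_lim => e e_gt0; have e4_gt0 : 0 < e / 4 by lra.
have [s [ts xs]] := tx _ e4_gt0; have [r [tr yr]] := ty _ e4_gt0.
have := cnorm_trans x (ev' s) y; have := cnorm_trans (ev' s) (ev' r) y.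
have := contractB s r; have := cnorm_trans (ev s) t (ev r).
rewrite (cnormBC _ t) (cnormBC (ev' r) y).
lra.
Qed.

Lemma tensor_graph_total t : exists t', tensor_graph t t'.
Proof.
have inv_gt0 n : 0 < (n.+1%:R^-1 : R) by rewrite invr_gt0 ltr0n.
have /choice[s sP] := fun n => dense t (inv_gt0 n).
have inv_small (e : R) : 0 < e ->
    exists N, forall n, (N <= n)%N -> n.+1%:R^-1 < e.
  move=> e_gt0; exists (Num.truncn e^-1) => n le_n.
  rewrite invf_plt ?posrE ?ltr0n //.
  by apply: lt_le_trans (truncnS_gt _) _; rewrite ler_nat.
have [|t' t'P] := @cnorm_complete _ T' (fun n => ev' (s n)).
  move=> e e_gt0; have e2_gt0 : 0 < e / 2 by lra.
  have [N NP] := inv_small _ e2_gt0; exists N => m n le_m le_n.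
  have := contractB (s m) (s n); have := cnorm_trans (ev (s m)) t (ev (s n)).
  rewrite (cnormBC _ t).
  have := lt_trans (sP m) (NP _ le_m); have := lt_trans (sP n) (NP _ le_n).
  lra.
exists t' => e e_gt0; have [N NP] := inv_small _ e_gt0.
have [M MP] := t'P _ e_gt0; exists (s (maxn N M)).
split; last by rewrite cnormBC MP // leq_maxr.
by apply: lt_trans (sP _) _; apply: NP; rewrite leq_maxl.
Qed.

Lemma tensor_graph_eval s : tensor_graph (ev s) (ev' s).
Proof. by move=> e e_gt0; exists s; rewrite !subrr !cnorm0. Qed.

Lemma tensor_graphD x y x' y' :
  tensor_graph x x' -> tensor_graph y y' -> tensor_graph (x + y) (x' + y').
Proof.
move=> xx' yy' e e_gt0; have e2_gt0 : 0 < e / 2 by lra.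
have [s [xs x's]] := xx' _ e2_gt0; have [r [yr y'r]] := yy' _ e2_gt0.
exists (s ++ r); rewrite !tensor_eval_cat !opprD !addrA.
rewrite (addrAC x) (addrAC x') -!(addrA _ y) -!(addrA _ y').
split; [have := cnormD (x - ev s) (y - ev r)
       |have := cnormD (x' - ev' s) (y' - ev' r)]; lra.
Qed.

Lemma tensor_graphZ c x x' :
  tensor_graph x x' -> tensor_graph (c *: x) (c *: x').
Proof.
move=> xx' e e_gt0; pose n := ComplexField.Normc.normc c.
have n_ge0 : 0 <= n by case: (c) @n => a b /=; exact: sqrtr_ge0.
have n1_gt0 : 0 < n + 1 by lra.
have [s [xs x's]] := xx' (e / (n + 1)) (divr_gt0 e_gt0 n1_gt0).
exists (scale_seq c s); rewrite !tensor_eval_scale -!scalerBr !cnormZ -/n.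
have bound (r : R) : 0 <= r -> r < e / (n + 1) -> n * r < e.
  by move=> r_ge0; rewrite ltr_pdivlMr //; nra.
by split; apply: bound; rewrite ?cnorm_ge0.
Qed.

Lemma tensor_graphM x y x' y' :
  tensor_graph x x' -> tensor_graph y y' -> tensor_graph (x * y) (x' * y').
Proof.
move=> xx' yy' e e_gt0.
pose M := 2 + cnorm x + cnorm y + cnorm x' + cnorm y'.
have := cnorm_ge0 x; have := cnorm_ge0 y; have := cnorm_ge0 x'.
have := cnorm_ge0 y' => y'_ge0 x'_ge0 y_ge0 x_ge0.
have M_gt0 : 0 < M by rewrite /M; lra.
pose d := Num.min 1 (e / M).
have d_gt0 : 0 < d by rewrite lt_min ltr01 divr_gt0.
have d_le1 : d <= 1 by rewrite ge_min lexx.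
have dM : d * M <= e by rewrite -ler_pdivlMr // ge_min lexx orbT.
have [s [xs x's]] := xx' _ d_gt0; have [r [yr y'r]] := yy' _ d_gt0.
exists (mul_seq s r); rewrite !tensor_eval_mul //.
have := cnorm_mul_close d_le1 xs yr; have := cnorm_mul_close d_le1 x's y'r.
rewrite /M in dM; split; nra.
Qed.

Lemma tensor_graph_star x x' :
  tensor_graph x x' -> tensor_graph (star x) (star x').
Proof.
move=> xx' e e_gt0; have [s [xs x's]] := xx' _ e_gt0.
exists (star_seq s); rewrite !tensor_eval_star //.
by rewrite -!starN -!starD !cnorm_star_eq.
Qed.

(** A contractive map on a dense *-subalgebra extends by continuity: the closed
    graph is that of a total function, by density and completeness, and it is
    stable under the operations of a *-algebra. *)
Lemma tensor_extension : exists F : {lrmorphism T -> T'},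
  [/\ star_hom F, forall a, F (il a) = il' a & forall b, F (ir b) = ir' b].
Proof.
have [F FP] := choice tensor_graph_total.
have F_eq t t' : tensor_graph t t' -> F t = t'.
  by move=> tt'; exact: tensor_graph_fun (FP t) tt'.
have F_linear : linear F.
  move=> c x y; apply: F_eq; apply: tensor_graphD => //.
  exact: tensor_graphZ.
have F1 : F 1 = 1.
  apply: F_eq; have := tensor_graph_eval [:: (1, 1)].
  by rewrite !tensor_eval1 !rmorph1 !mulr1.
have F_mul : monoid_morphism F.
  by split=> // x y; apply: F_eq; exact: tensor_graphM.
pose F_lin := GRing.isLinear.Build _ _ _ _ F F_linear.
pose F_mon := GRing.isMonoidMorphism.Build _ _ F F_mul.
pose F' : {lrmorphism T -> T'} := HB.pack F F_lin F_mon.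
exists F'; split=> [x|a|b]; apply: F_eq.
- exact: tensor_graph_star.
- have := tensor_graph_eval [:: (a, 1)].
  by rewrite !tensor_eval1 !rmorph1 !mulr1.
- have := tensor_graph_eval [:: (1, b)].
  by rewrite !tensor_eval1 !rmorph1 !mul1r.
Qed.

End Extension.

Section TensorIso.
Variables (R : realType) (G H : comulAlg R).
Variables (phi : {lrmorphism G -> H}) (psi : {lrmorphism H -> G}).
Hypotheses (phi_star : star_hom phi) (psi_star : star_hom psi).
Hypotheses (phiK : cancel phi psi) (psiK : cancel psi phi).

Definition map_pairs (s : seq (H * H)) : seq (G * G) :=
  [seq (psi p.1, psi p.2) | p <- s].

Lemma tensor_null_iso s : tensor_null (map_pairs s) -> tensor_null s.
Proof.
move=> null V f.
pose g (x y : G) : V := f (phi x) (phi y).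
have g_bilin : bilinear_for *:%R *:%R g.
  by split=> [y a x x'|x a y y']; rewrite /g linearP ?linearPl ?linearPr.
pose g_mix := bilinear_isBilinear.Build _ _ _ _ _ _ g g_bilin.
pose g' : {bilinear G -> G -> V} := HB.pack g g_mix.
have := null V g'; rewrite big_map /= /g.
by under eq_bigr do rewrite !psiK.
Qed.

(** Pulled back along psi, the tensor norm of G is a C*-norm on the algebraic
    tensor square of H, so it dominates the minimal one; hence phi (x) phi is
    contractive on formal tensors. *)
Lemma tensor_iso : exists F : {lrmorphism ctensor G -> ctensor H},
  [/\ star_hom F, forall x, F (tinl G x) = tinl H (phi x)
    & forall x, F (tinr G x) = tinr H (phi x)].
Proof.
have [[lG_star rG_star commG nullG] denseG _] := ctensorP G.
have [[lH_star rH_star commH nullH] _ minH] := ctensorP H.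
apply: (@tensor_extension _ _ _ _ _ (tinl G) (tinr G)
  (tinl H \o phi) (tinr H \o phi)) => //=.
- exact: comp_star_hom.
- exact: comp_star_hom.
move=> s.
have emb : tensor_embedding (tinl G \o psi) (tinr G \o psi).
  split=> //=; try exact: comp_star_hom.
  move=> r r0; apply: tensor_null_iso; apply: nullG.
  by rewrite -r0 /tensor_eval big_map.
have := minH _ _ _ emb [seq (phi p.1, phi p.2) | p <- s].
rewrite /tensor_eval !big_map /=.
by under [X in _ <= cnorm X]eq_bigr do rewrite !phiK.
Qed.

End TensorIso.

(** * The isomorphism *)

Section MatrixComul.
Variables (R : realType) (H : comulAlg R) (n m1 m2 : nat).
Variables (pi1 : 'I_n -> 'I_m1) (pi2 : 'I_n -> 'I_m2).
Hypothesis pi_bij : bijective (fun i => (pi1 i, pi2 i)).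

Lemma prod_matrix_comul (v : 'M[H]_m1) (w : 'M[H]_m2) :
  matrix_comul v -> matrix_comul w -> matrix_comul (prod_mx pi1 pi2 v w).
Proof.
have [[_ _ comm _] _ _] := ctensorP H.
move=> v_comul w_comul i j; rewrite mxE rmorphM /= v_comul w_comul.
under [RHS]eq_bigr do rewrite !mxE !rmorphM.
rewrite (sum_prod_index pi_bij (fun a b =>
  tinl H (v (pi1 i) a) * tinl H (w (pi2 i) b) *
  (tinr H (v a (pi1 j)) * tinr H (w b (pi2 j))))).
rewrite mulr_suml; apply: eq_bigr => a _; rewrite mulr_sumr.
apply: eq_bigr => b _.
by rewrite -!mulrA (mulrA (tinr H _)) -comm !mulrA.
Qed.

End MatrixComul.

Section StarHom.
Variables (R : realType) (A B : cstarAlgType R) (f : {lrmorphism A -> B}).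
Hypothesis f_star : star_hom f.

Lemma magic_map n (u : 'M[A]_n) : magic u -> magic (map_mx f u).
Proof.
case=> u_proj u_row u_col; split=> [i j|i|i].
- have [u_sa u_idem] := u_proj i j.
  by rewrite mxE; split; rewrite -?f_star -?rmorphM ?u_sa ?u_idem.
- by under eq_bigr do rewrite mxE; rewrite -rmorph_sum u_row rmorph1.
- by under eq_bigr do rewrite mxE; rewrite -rmorph_sum u_col rmorph1.
Qed.

Lemma preserves_map n (S : eqType) (e : 'I_n -> 'I_n -> S) (u : 'M[A]_n) :
  preserves e u -> preserves e (map_mx f u).
Proof. by move=> eu i j k l /eu uu; rewrite !mxE -rmorphM uu rmorph0. Qed.

Lemma qaut_rel_map n (e : rel 'I_n) (u : 'M[A]_n) :
  qaut_rel e u -> qaut_rel e (map_mx f u).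
Proof.
case=> u_magic eu; have fu_magic := magic_map u_magic; split=> //.
by apply/preserves_adjmx => //; apply: preserves_map; apply/preserves_adjmx.
Qed.

Lemma quot_map n m (pi : 'I_n -> 'I_m) s (u : 'M[A]_n) x y :
  f (quot_mx pi s u x y) = quot_mx pi s (map_mx f u) x y.
Proof.
by rewrite !mxE raddf_sum; apply: eq_bigr => j _; rewrite mxE.
Qed.

End StarHom.

Lemma universal_ext (R : realType) (X : Type) (rel : relations R X)
    (A B : cstarAlgType R) (g : X -> A) (f f' : {lrmorphism A -> B}) :
    is_universal rel g -> rel B (fun x => f (g x)) ->
    star_hom f -> star_hom f' -> (forall x, f (g x) = f' (g x)) ->
  f =1 f'.
Proof.
case=> _ univ rel_f f_star f'_star ff' a.
have [h [_ _ h_uniq]] := univ B _ rel_f.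
by rewrite (h_uniq f) // (h_uniq f').
Qed.

Theorem proposition7p2 (R : realType) (G H : comulAlg R) :
  is_qaut C12_3p6 G -> is_H2plus_prod_S3 H -> cqg_isomorphic G H.
Proof.
case=> u [univG u_comul] [v [w [univH v_comul w_comul]]].
have matrix_eta (A : cstarAlgType R) n (x : 'M[A]_n) : \matrix_(i, j) x i j = x.
  by apply/matrixP => i j; rewrite mxE.
have u_rel : qaut_rel C12_3p6 u by case: univG => + _; rewrite matrix_eta.
have [v_rel w_magic vw_comm] : [/\ qaut_rel C4 v, magic w &
    forall i j k l, v i j * w k l = w k l * v i j].
  by case: univH => -[]; rewrite !matrix_eta.
have u_magic : magic u by case: u_rel.
have v_magic : magic v by case: v_rel.
case: (pos_blk_bij) => p _ pK.
pose s1 x := p (x, ord0); pose s2 k := p (ord0, k).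
have s1K : cancel s1 pos by move=> x; case: (pK (x, ord0)).
have s2K : cancel s2 blk by move=> k; case: (pK (ord0, k)).
have pos_u := pos_preserved u_rel; have blk_u := blk_preserved u_rel.
have [|phi [phi_star phi_u _]] :=
    univG.2 H (fun x => prod_mx pos blk v w x.1 x.2).
  by rewrite matrix_eta; exact: prod_qaut.
have [|psi [psi_star psi_vw _]] := univH.2 G (fun x =>
    match x with
    | inl q => quot_mx pos s1 u q.1 q.2
    | inr q => quot_mx blk s2 u q.1 q.2
    end).
  rewrite !matrix_eta; have V_magic := quot_magic s1K u_magic pos_u.
  split; [split=> //|exact: quot_magic|].
    apply/preserves_adjmx => //; apply: quot_preserves => //.
    exact: C4_pos_preserved.
  exact: (quot_quot_comm pos_blk_bij s1K s2K u_magic pos_u blk_u).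
have phi_map : map_mx phi u = prod_mx pos blk v w.
  by apply/matrixP => i j; rewrite mxE (phi_u (i, j)).
have psi_v x y : psi (v x y) = quot_mx pos s1 u x y := psi_vw (inl (x, y)).
have psi_w k l : psi (w k l) = quot_mx blk s2 u k l := psi_vw (inr (k, l)).
have phiK : cancel phi psi.
  move=> a; symmetry.
  apply: (universal_ext (f := idfun) (f' := psi \o phi) univG) => //=.
  - by rewrite matrix_eta.
  - exact: comp_star_hom.
  move=> [i j] /=; rewrite (phi_u (i, j)) mxE rmorphM /= psi_v psi_w.
  by rewrite (quot_quot_mul pos_blk_bij s1K s2K).
have psiK : cancel psi phi.
  move=> b; symmetry.
  apply: (universal_ext (f := idfun) (f' := phi \o psi) univH) => //=.
  - by rewrite !matrix_eta.
  - exact: comp_star_hom.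
  case=> [[x y]|[k l]] /=; rewrite ?psi_v ?psi_w quot_map phi_map.
    by rewrite (quot_prod_l pos_blk_bij).
  by rewrite (quot_prod_r pos_blk_bij).
have [F [F_star F_l F_r]] := tensor_iso phi_star psi_star phiK psiK.
exists phi, F; split=> //; first by exists psi.
have prod_comul := prod_matrix_comul pos_blk_bij v_comul w_comul.
apply: (universal_ext (f := F \o comul G) (f' := comul H \o phi) univG) => //=.
- have := qaut_rel_map (comp_star_hom (@comul_star _ G) F_star) u_rel.
  by congr (qaut_rel _ _); apply/matrixP => i j; rewrite !mxE.
- exact: comp_star_hom (@comul_star _ G) F_star.
- exact: comp_star_hom phi_star (@comul_star _ H).
move=> [i j] /=; rewrite u_comul (phi_u (i, j)) prod_comul rmorph_sum /=.
apply: eq_bigr => k _.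
by rewrite rmorphM /= F_l F_r (phi_u (i, k)) (phi_u (k, j)).
Qed.
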